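(* Let $Y$ be a finite set of variables, $X \subseteq Y$, and $Z,P\subseteq\mathbb{Q}[Y]$ finite sets of polynomials. Then \[ \mathrm{alg.cone}_X(\mathit{project}_X(Z,P)) = \mathrm{alg.cone}_Y(Z,P) \cap \mathbb{Q}[X]. \]
   Context: For finite $Z,P \subseteq \mathbb{Q}[V]$, $\mathrm{alg.cone}_V(Z,P) = \langle Z\rangle_V + \mathrm{cone}(P)$, where $\langle Z\rangle_V$ is the ideal of $\mathbb{Q}[V]$ generated by $Z$ and $\mathrm{cone}(P)$ is the set of non-negative rational combinations of elements of $P$. Fix a monomial ordering $\preceq$. Every monomial $m$ over $Y$ factors uniquely as $m_X m_{\overline X}$ with $m_X$ a monomial over $X$ and $m_{\overline X}$ over $Y\setminus X$; the elimination ordering $\preceq_X$ is defined by $m \preceq_X n$ iff $m_{\overline X} \prec n_{\overline X}$, or $m_{\overline X}=n_{\overline X}$ and $m_X\preceq n_X$. For a finite set of polynomials $S$ and a set of monomials $N$, $\mathrm{proj}(S,N)$ denotes a finite set of polynomials (e.g. obtained by Fourier–Motzkin elimination of the monomials not in $N$) with $\mathrm{cone}(\mathrm{proj}(S,N)) = \mathrm{cone}(S) \cap \mathrm{span}_{\mathbb{Q}}(N)$. Let $[X]$ be the set of monomials over $X$. Define $\mathit{project}_X(Z,P) = \langle G \cap \mathbb{Q}[X],\ \mathrm{proj}(\{\mathbf{red}_G(p): p\in P\}, [X])\rangle$, where $G$ is a Gröbner basis of the ideal of $\mathbb{Q}[Y]$ generated by $Z$ with respect to $\preceq_X$ and $\mathbf{red}_G$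 is the normal form modulo $G$. *)

(* Defs.v *)
From HB Require Import structures.
From mathcomp Require Import all_boot all_order all_algebra.
From mathcomp Require Import finmap mpoly.
From Stdlib Require Import Relation_Operators ClassicalEpsilon.

Set Implicit Arguments.
Unset Strict Implicit.
Unset Printing Implicit Defensive.

Import Order.TTheory GRing.Theory Num.Theory.

Local Open Scope fset_scope.
Local Open Scope ring_scope.

(* The variables Y are the n variables of {mpoly rat[n]}; a subset V of Y is a
   set of indices, and Q[V] is the corresponding subring of Q[Y]. *)

Section Monomials.
Variable n : nat.
Implicit Types (V X : {set 'I_n}) (m : 'X_{1..n}).

Definition monomials V : pred 'X_{1..n} :=
  [pred m : 'X_{1..n} | [forall i, (i \notin V) ==> (m i == 0%N)]].

Definition polys V : pred {mpoly rat[n]} :=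
  [pred p : {mpoly rat[n]} | all (monomials V) (msupp p)].

Definition mrestr V m : 'X_{1..n} :=
  [multinom (if i \in V then m i else 0%N) | i < n].

Definition monomial_order (le : rel 'X_{1..n}) : Prop :=
  [/\ reflexive le, antisymmetric le, transitive le, total le
    & (forall m, le 0%MM m) /\
      (forall m1 m2 m, le m1 m2 -> le (m1 + m)%MM (m2 + m)%MM)].

Definition elim_order (le : rel 'X_{1..n}) X : rel 'X_{1..n} :=
  fun m1 m2 =>
    let o1 := mrestr (~: X) m1 in
    let o2 := mrestr (~: X) m2 in
    (le o1 o2 && (o1 != o2)) || ((o1 == o2) && le (mrestr X m1) (mrestr X m2)).

End Monomials.

Section Cones.
Variable n : nat.
Implicit Types (V : {set 'I_n}) (p q : {mpoly rat[n]}).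
Implicit Types (Z P S : {fset {mpoly rat[n]}}).

(* The ideal of Q[V], not of Q[Y]: the multipliers range over Q[V]. *)
Definition ideal V Z q : Prop :=
  exists2 a : {mpoly rat[n]} -> {mpoly rat[n]},
    forall z, polys V (a z) & q = \sum_(z <- Z) a z * z.

Definition cone P q : Prop :=
  exists2 c : {mpoly rat[n]} -> rat,
    forall p, 0 <= c p & q = \sum_(p <- P) c p *: p.

Definition alg_cone V (ZP : {fset {mpoly rat[n]}} * {fset {mpoly rat[n]}}) q :
    Prop :=
  exists z p, [/\ ideal V ZP.1 z, cone ZP.2 p & q = z + p].

Definition mono_span (N : pred 'X_{1..n}) q : Prop :=
  exists (s : seq 'X_{1..n}) (c : 'X_{1..n} -> rat),
    all N s /\ q = \sum_(m <- s) c m *: 'X_[m].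

Definition is_proj S (N : pred 'X_{1..n}) S' : Prop :=
  forall q, cone S' q <-> cone S q /\ mono_span N q.

End Cones.

Section Groebner.
Variables (n : nat) (le : rel 'X_{1..n}).
Implicit Types (p q r g : {mpoly rat[n]}) (Z G : {fset {mpoly rat[n]}}).

Definition is_lead p (m : 'X_{1..n}) : Prop :=
  m \in msupp p /\ {in msupp p, forall m', le m' m}.

Definition groebner_basis Z G : Prop :=
  (forall g, g \in G -> ideal [set: 'I_n] Z g) /\
  (forall f m, ideal [set: 'I_n] Z f -> is_lead f m ->
     exists g l, [/\ g \in G, is_lead g l & (l <= m)%MM]).

Definition reduces G p q : Prop :=
  exists g l m, [/\ g \in G, is_lead g l, m \in msupp p, (l <= m)%MM
    & q = p - (p@_m / g@_l) *: ('X_[m - l] * g)].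

Definition normal_form G p r : Prop :=
  clos_refl_trans _ (reduces G) p r /\ forall q, ~ reduces G r q.

(* Normal forms exist when le is a monomial order, and are unique when G is
   moreover a Groebner basis. *)
Definition red G p : {mpoly rat[n]} :=
  epsilon (inhabits (0 : {mpoly rat[n]})) (normal_form G p).

End Groebner.

(* A relation, since neither the Groebner basis nor the finite set of generators
   of the projected cone is unique. *)
Definition is_project n (le : rel 'X_{1..n}) (X : {set 'I_n})
    (Z P : {fset {mpoly rat[n]}})
    (ZP' : {fset {mpoly rat[n]}} * {fset {mpoly rat[n]}}) : Prop :=
  let leX := elim_order le X in
  exists G : {fset {mpoly rat[n]}},
    [/\ groebner_basis leX Z G,
        ZP'.1 = [fset g in G | polys X g]
      & is_proj [fset red leX G p | p in P] (monomials X) ZP'.2].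

(* Main.v *)
Require Import Defs.
From mathcomp Require Import all_boot all_order all_algebra.
From mathcomp Require Import finmap mpoly.
From Stdlib Require Import Relation_Operators Classical ClassicalEpsilon.

Set Implicit Arguments.
Unset Strict Implicit.
Unset Printing Implicit Defensive.

Import Order.TTheory GRing.Theory Num.Theory.

Local Open Scope fset_scope.
Local Open Scope ring_scope.

(** The elimination order is a monomial order, hence well founded by Dickson's
    lemma, so normal forms modulo [G] exist. A polynomial and its normal form
    differ by an element of the ideal of [Z], which gives the inclusion from
    left to right. Conversely, let [q = z + \sum_p c_p p] be in [Q[X]].
    A leading monomial dividing a monomial over [X] is itself over [X], and
    then the whole element of [G] is in [Q[X]]; thus reducing [q] only uses
    elements of [G] in [Q[X]], and [red q] is in [Q[X]]. Both [red q] and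
    [\sum_p c_p (red p)] are irreducible and they differ by an element of the
    ideal, so they are equal; this element of [cone (red P)] is in [Q[X]]. *)

(** * Nondecreasing subsequences and Dickson's lemma *)

Section NondecreasingSubsequences.

Lemma exists_argmin_from (g : nat -> nat) (N : nat) :
  exists2 i, (N <= i)%N & forall j, (N <= j)%N -> (g i <= g j)%N.
Proof.
(* The induction is on a bound [k] for the value [g i]: a strictly smaller value further on lowers
   that bound. *)
suff H k : forall i, (N <= i)%N -> (g i <= k)%N ->
    exists2 i, (N <= i)%N & forall j, (N <= j)%N -> (g i <= g j)%N.
  exact: (H (g N) N).
elim: k => [|k IHk] i Ni gik.
  by exists i => // j _; move: gik; rewrite leqn0 => /eqP ->.
have [[j Nj ltj]|nej] := classic (exists2 j, (N <= j)%N & (g j < g i)%N).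
  by apply: (IHk j Nj); rewrite -ltnS; apply: leq_trans ltj gik.
exists i => // j Nj; rewrite leqNgt; apply/negP => ltj.
by apply: nej; exists j.
Qed.

(** Each index is chosen past the previous one so as to minimise [g] over the whole remaining tail;
    later values come from that tail and cannot be smaller. *)
Lemma nondecreasing_subseq (g : nat -> nat) :
  exists2 phi : nat -> nat, {homo phi : i j / (i < j)%N} &
    {homo (g \o phi) : i j / (i <= j)%N}.
Proof.
have /choice[h hP] : forall N, exists i, (N <= i)%N /\
    forall j, (N <= j)%N -> (g i <= g j)%N.
  by move=> N; have [i Ni min_i] := exists_argmin_from g N; exists i.
pose phi := fix phi k := if k is k'.+1 then h (phi k').+1 else h 0%N.
have phi_ltS k : (phi k < phi k.+1)%N by case: (hP (phi k).+1).
have phi_lt : {homo phi : i j / (i < j)%N}.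
  by apply: homo_ltn => //; apply: ltn_trans.
exists phi => // i j; rewrite leq_eqVlt => /predU1P[->//|ltij] /=.
have phi_le := phi_lt _ _ ltij.
case: i phi_le {ltij} => [|i] phi_le /=; first by case: (hP 0%N) => _; apply.
by case: (hP (phi i).+1) => _; apply; apply: leq_trans (ltnW phi_le).
Qed.

(** Passing to a subsequence once per variable makes every exponent nondecreasing along it, so its
    first two terms serve. *)
Lemma dickson n (f : nat -> 'X_{1..n}) :
  exists i j, (i < j)%N /\ (f i <= f j)%MM.
Proof.
suff [phi phi_lt phi_le] : exists2 phi : nat -> nat,
    {homo phi : i j / (i < j)%N} &
    forall t : 'I_n, t \in enum 'I_n ->
      {homo (fun i => f (phi i) t) : i j / (i <= j)%N}.
  exists (phi 0%N), (phi 1%N); split; first exact: phi_lt.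
  by apply/mnm_lepP => t; apply: (phi_le t) => //; rewrite mem_enum.
elim: (enum 'I_n) => [|t s [phi phi_lt phi_le]]; first by exists id.
have [psi psi_lt psi_le] := nondecreasing_subseq (fun i => f (phi i) t).
exists (phi \o psi) => [i j ltij|u]; first exact/phi_lt/psi_lt.
rewrite inE => /predU1P[->|us] i j leij /=; first exact: psi_le leij.
apply: (phi_le u us); move: leij; rewrite leq_eqVlt => /predU1P[->//|ltij].
exact/ltnW/psi_lt.
Qed.

End NondecreasingSubsequences.

(** * Monomial orders and the elimination order *)

Section MonomialOrders.
Variable n : nat.
Implicit Types (le : rel 'X_{1..n}) (X : {set 'I_n}) (m l : 'X_{1..n}).

Definition strict le : rel 'X_{1..n} := fun m1 m2 => le m1 m2 && (m1 != m2).

Lemma monomial_order_lepm le : monomial_order le ->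
  forall m1 m2, (m1 <= m2)%MM -> le m1 m2.
Proof.
case=> _ _ _ _ [le0 leD] m1 m2 /submK <-.
by have := leD _ _ m1 (le0 (m2 - m1)%MM); rewrite add0m.
Qed.

Lemma strict_le_trans le : monomial_order le ->
  forall m1 m2 m3, strict le m1 m2 -> le m2 m3 -> strict le m1 m3.
Proof.
case=> le_refl le_anti le_trans _ _ m1 m2 m3 /andP[le12 ne12] le23.
rewrite /strict (le_trans _ _ _ le12 le23) /=; apply: contraNneq ne12 => e.
by apply/eqP/le_anti; rewrite le12 /= e.
Qed.

(** In a strictly descending chain Dickson's lemma finds an earlier term dividing a later one;
    divisibility implies [le], against the descent. *)
Lemma monomial_order_wf le : monomial_order le -> well_founded (strict le).
Proof.
move=> hle m; apply: NNPP => nAm.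
(* Classically, a non-accessible monomial has a strictly smaller non-accessible one; iterating [nxt]
   builds the descending chain. *)
have /choice[nxt nxtP] : forall m1, exists m2,
    ~ Acc (strict le) m1 -> strict le m2 m1 /\ ~ Acc (strict le) m2.
  move=> m1; have [A1|nA1] := classic (Acc (strict le) m1); first by exists m1.
  apply: NNPP => nex; apply: nA1; constructor => m2 lt21.
  by apply: NNPP => nA2; apply: nex; exists m2.
pose f k := iter k nxt m.
have fP k : ~ Acc (strict le) (f k) by elim: k => // k /nxtP[].
have f_lt i j : (i < j)%N -> strict le (f j) (f i).
  elim: j => // j IHj; rewrite ltnS leq_eqVlt => /predU1P[->|/IHj ltji].
    by case: (nxtP _ (fP j)).
  apply: strict_le_trans (proj1 (nxtP _ (fP j))) _ => //.
  by case/andP: ltji.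
have [i [j [/f_lt ltji /(monomial_order_lepm hle) leij]]] := dickson f.
by have /andP[_] := strict_le_trans hle ltji leij; rewrite eqxx.
Qed.

Lemma mrestr_monomials X m : monomials X m -> mrestr (~: X) m = 0%MM.
Proof.
move=> /forallP hm; apply/mnmP => i; rewrite mnmE mnm0E inE.
by case: ifP => // /(implyP (hm i)) /eqP.
Qed.

Lemma monomials_mrestr X m : mrestr (~: X) m = 0%MM -> monomials X m.
Proof.
move=> /mnmP hm; apply/forallP => i; apply/implyP => iX.
by have := hm i; rewrite mnmE mnm0E inE iX => ->.
Qed.

Lemma mrestrD X m1 m2 : mrestr X (m1 + m2) = (mrestr X m1 + mrestr X m2)%MM.
Proof. by apply/mnmP => i; rewrite !mnmE; case: ifP. Qed.

Lemma mrestr0 X : mrestr X 0%MM = 0%MM.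
Proof. by apply/mnmP => i; rewrite !mnmE; case: ifP. Qed.

Lemma mrestr_inj X m1 m2 :
  mrestr X m1 = mrestr X m2 -> mrestr (~: X) m1 = mrestr (~: X) m2 -> m1 = m2.
Proof.
move=> /mnmP e1 /mnmP e2; apply/mnmP => i.
by have := e1 i; have := e2 i; rewrite !mnmE inE; case: (i \in X).
Qed.

Lemma elim_orderE le X m1 m2 : elim_order le X m1 m2 =
  strict le (mrestr (~: X) m1) (mrestr (~: X) m2) ||
  (mrestr (~: X) m1 == mrestr (~: X) m2) && le (mrestr X m1) (mrestr X m2).
Proof. by []. Qed.

(** This is a lexicographic product: the part outside [X] is compared first, then the part in [X].
    Each axiom follows by cases on which part decides. *)
Lemma elim_order_monomial_order le X :
  monomial_order le -> monomial_order (elim_order le X).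
Proof.
move=> hle; have [le_refl le_anti le_trans le_total [le0 leD]] := hle.
have lt_anti m1 m2 : strict le m1 m2 -> le m2 m1 -> False.
  by move=> /(strict_le_trans hle) h /h /andP[_]; rewrite eqxx.
split; [| | | |split].
- by move=> m; rewrite elim_orderE eqxx le_refl orbT.
- move=> m1 m2 /andP[]; rewrite !elim_orderE.
  case/orP=> [lt12|/andP[/eqP e12 le12]].
    case/orP=> [/andP[le21 _]|/andP[/eqP e21 _]].
      by case: (lt_anti _ _ lt12 le21).
    by move: lt12; rewrite /strict e21 eqxx andbF.
  rewrite e12 /strict eqxx andbF /= => le21.
  by apply: mrestr_inj e12; apply: le_anti; rewrite le12.
- move=> m2 m1 m3; rewrite !elim_orderE.
  case/orP=> [lt12|/andP[/eqP -> le12]].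
    case/orP=> [/andP[le23 _]|/andP[/eqP <- _]]; last by rewrite lt12.
    by rewrite (strict_le_trans hle lt12 le23).
  case/orP=> [->//|/andP[-> le23]].
  by rewrite (le_trans _ _ _ le12 le23) orbT.
- move=> m1 m2; rewrite !elim_orderE /strict eq_sym.
  case: eqP => [_|_]; first by rewrite !andbF; apply: le_total.
  by rewrite !andbT !orbF; apply: le_total.
- move=> m; rewrite elim_orderE !mrestr0 /strict le0 le0 /=.
  by case: eqP.
- move=> m1 m2 m; rewrite !elim_orderE !mrestrD /strict.
  (* Cancelling [m] leaves the equality tests unchanged, so the same part decides after the
     translation. *)
  rewrite !(inj_eq (@addIm _ _)).
  case/orP=> [/andP[/leD -> ->]//|/andP[-> /leD ->]].
  by rewrite orbT.
Qed.

(** The part of [l] outside [X] is zero, the least monomial, so the corresponding part of [m] must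
    be zero too. *)
Lemma elim_order_monomials le X m l : monomial_order le ->
  elim_order le X m l -> monomials X l -> monomials X m.
Proof.
move=> [_ le_anti _ _ [le0 _]]; rewrite elim_orderE => le_ml hl.
move: le_ml; rewrite (mrestr_monomials hl).
case/orP=> [/andP[le_m0 /eqP ne]|/andP[/eqP e _]]; last exact: monomials_mrestr.
by case: ne; apply: le_anti; rewrite le_m0 le0.
Qed.

Lemma monomials_lepm X m l : (l <= m)%MM -> monomials X m -> monomials X l.
Proof.
move=> /mnm_lepP lem /forallP hm; apply/forallP => i; apply/implyP.
by move=> /(implyP (hm i)) /eqP mi0; rewrite -leqn0 -mi0.
Qed.

Lemma monomialsD X m l :
  monomials X m -> monomials X l -> monomials X (m + l)%MM.
Proof.
move=> /mrestr_monomials hm /mrestr_monomials hl.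
by apply: monomials_mrestr; rewrite mrestrD hm hl addm0.
Qed.

(** With [P] trivial this yields leading monomials; with [P] the property [reducible], the monomial
    at which to reduce. *)
Lemma exists_max_mnm le (s : seq 'X_{1..n}) (P : 'X_{1..n} -> Prop) :
  monomial_order le -> (exists2 m, m \in s & P m) ->
  exists2 m, m \in s /\ P m & forall m', m' \in s -> P m' -> le m' m.
Proof.
move=> [le_refl _ le_trans le_total _]; elim: s => [|a s IHs] [m //].
have [[m1 m1s Pm1] _ _|nes] := classic (exists2 m, m \in s & P m).
  have [|m2 [m2s Pm2] max2] := IHs; first by exists m1.
  have [Pa|nPa] := classic (P a); last first.
    exists m2; first by rewrite inE m2s orbT.
    by move=> m'; rewrite inE => /predU1P[->|/max2].
  case/orP: (le_total a m2) => [lea|le2].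
    exists m2; first by rewrite inE m2s orbT.
    by move=> m'; rewrite inE => /predU1P[->|/max2].
  exists a; first by rewrite inE eqxx.
  move=> m'; rewrite inE => /predU1P[->//|m's Pm'].
  by apply: le_trans le2; apply: max2.
rewrite inE => /predU1P[-> Pa|ms Pm]; last by case: nes; exists m.
exists a; first by rewrite inE eqxx.
by move=> m'; rewrite inE => /predU1P[->//|m's Pm']; case: nes; exists m'.
Qed.

End MonomialOrders.

(** * The subring of polynomials over a set of variables *)

Section PolynomialSubrings.
Variables (n : nat) (V : {set 'I_n}).
Implicit Types (p q : {mpoly rat[n]}).

Lemma polysP p : reflect (forall m, m \in msupp p -> monomials V m) (polys V p).
Proof. exact: allP. Qed.

Lemma polys0 : polys V 0.
Proof. by apply/polysP => m; rewrite msupp0. Qed.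

Lemma polysD p q : polys V p -> polys V q -> polys V (p + q).
Proof.
move=> /polysP hp /polysP hq; apply/polysP => m /msuppD_le.
by rewrite mem_cat => /orP[/hp|/hq].
Qed.

Lemma polysM p q : polys V p -> polys V q -> polys V (p * q).
Proof.
move=> /polysP hp /polysP hq; apply/polysP => m /msuppM_le.
by case/allpairsP=> -[m1 m2] /= [/hp h1 /hq h2 ->]; apply: monomialsD.
Qed.

Lemma polysZ (c : rat) p : polys V p -> polys V (c *: p).
Proof. by move=> /polysP hp; apply/polysP => m /msuppZ_le /hp. Qed.

Lemma polysX m : monomials V m -> polys V 'X_[m].
Proof. by move=> hm; apply/polysP => k; rewrite msuppX inE => /eqP ->. Qed.

Lemma polys1 : polys V 1.
Proof.
rewrite -mpolyX0; apply: polysX; apply/forallP => i.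
by rewrite mnm0E implybT.
Qed.

Lemma polys_sum (I : eqType) (s : seq I) (F : I -> {mpoly rat[n]}) :
  (forall i, i \in s -> polys V (F i)) -> polys V (\sum_(i <- s) F i).
Proof.
move=> hF; rewrite big_seq; apply: (big_ind (polys V)) => //.
- exact: polys0.
- exact: polysD.
Qed.

Lemma mono_span_polys p : mono_span (monomials V) p <-> polys V p.
Proof.
split=> [[s [c [/allP hs ->]]]|hp].
  by apply: polys_sum => m /hs hm; apply/polysZ/polysX.
by exists (msupp p), (fun m => p@_m); split; [exact: hp|exact: mpolyE].
Qed.

End PolynomialSubrings.

Lemma polysT n (p : {mpoly rat[n]}) : polys [set: 'I_n] p.
Proof.
by apply/polysP => m _; apply/forallP => i; rewrite in_setT.
Qed.

(** * Ideals, cones, and cones modulo an ideal *)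

Section IdealsAndCones.
Variables (n : nat).
Implicit Types (V : {set 'I_n}) (p q f g : {mpoly rat[n]}).
Implicit Types (Z P : {fset {mpoly rat[n]}}).

Lemma sum_fset_pick (M : zmodType) (S : {fset {mpoly rat[n]}}) g
    (F : {mpoly rat[n]} -> M) :
  g \in S -> \sum_(z <- S) (if z == g then F z else 0) = F g.
Proof.
move=> gS; rewrite (big_fsetD1 g) //= eqxx big_seq big1 ?addr0 // => z.
by rewrite !inE => /andP[/negPf ->].
Qed.

Lemma ideal0 V Z : ideal V Z 0.
Proof.
exists (fun=> 0) => [_|]; first exact: polys0.
by rewrite big1 // => z _; rewrite mul0r.
Qed.

Lemma idealD V Z f g : ideal V Z f -> ideal V Z g -> ideal V Z (f + g).
Proof.
move=> [a ha ->] [b hb ->]; exists (fun z => a z + b z) => [z|].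
  exact: polysD.
by rewrite -big_split; apply: eq_bigr => z _; rewrite mulrDl.
Qed.

Lemma idealM V Z f g : polys V f -> ideal V Z g -> ideal V Z (f * g).
Proof.
move=> hf [a ha ->]; exists (fun z => f * a z) => [z|]; first exact: polysM.
by rewrite mulr_sumr; apply: eq_bigr => z _; rewrite mulrA.
Qed.

Lemma idealZ V Z (c : rat) f : ideal V Z f -> ideal V Z (c *: f).
Proof.
move=> hf; rewrite -[f]mul1r scalerAl; apply: idealM => //.
exact/polysZ/polys1.
Qed.

Lemma idealB V Z f g : ideal V Z f -> ideal V Z g -> ideal V Z (f - g).
Proof. by move=> hf /(idealZ (-1)); rewrite scaleN1r; apply: idealD. Qed.

Lemma ideal_sum (I : eqType) (s : seq I) (F : I -> {mpoly rat[n]}) V Z :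
  (forall i, i \in s -> ideal V Z (F i)) -> ideal V Z (\sum_(i <- s) F i).
Proof.
move=> hF; rewrite big_seq; apply: (big_ind (ideal V Z)) => //.
- exact: ideal0.
- by move=> f g; apply: idealD.
Qed.

Lemma ideal_gen V Z g : g \in Z -> ideal V Z g.
Proof.
move=> gZ; exists (fun z => if z == g then 1 else 0) => [z|].
  by case: ifP => _; [exact: polys1|exact: polys0].
rewrite -[LHS](sum_fset_pick id gZ); apply: eq_bigr => z _.
by case: ifP; rewrite ?mul1r ?mul0r.
Qed.

Lemma cone0 P : cone P 0.
Proof.
by exists (fun=> 0) => //; rewrite big1 // => p _; rewrite scale0r.
Qed.

Lemma coneD P p q : cone P p -> cone P q -> cone P (p + q).
Proof.
move=> [a ha ->] [b hb ->]; exists (fun z => a z + b z) => [z|].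
  exact: addr_ge0.
by rewrite -big_split; apply: eq_bigr => z _; rewrite scalerDl.
Qed.

Lemma coneZ P (c : rat) p : 0 <= c -> cone P p -> cone P (c *: p).
Proof.
move=> c0 [a ha ->]; exists (fun z => c * a z) => [z|]; first exact: mulr_ge0.
by rewrite scaler_sumr; apply: eq_bigr => z _; rewrite scalerA.
Qed.

Lemma cone_gen P p : p \in P -> cone P p.
Proof.
move=> pP; exists (fun z => if z == p then 1 else 0) => [z|].
  by case: ifP.
rewrite -[LHS](sum_fset_pick id pP); apply: eq_bigr => z _.
by case: ifP; rewrite ?scale1r ?scale0r.
Qed.

Lemma cone_sum (I : eqType) (s : seq I) (F : I -> {mpoly rat[n]}) P :
  (forall i, i \in s -> cone P (F i)) -> cone P (\sum_(i <- s) F i).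
Proof.
move=> hF; rewrite big_seq; apply: (big_ind (cone P)) => //.
- exact: cone0.
- by move=> f g; apply: coneD.
Qed.

(** Exchanging each generator for a congruent one, with the coefficients kept, changes the sum by an
    element of the ideal. It serves to pass from normal forms back to [P]. *)
Lemma cone_mod_ideal V Z P (P' : {fset {mpoly rat[n]}}) q :
  (forall p', p' \in P' -> exists2 p, p \in P & ideal V Z (p - p')) ->
  cone P' q -> exists2 p, cone P p & ideal V Z (p - q).
Proof.
move=> hP' [c c0 ->].
have /choice[r rP] : forall p', exists p,
    p' \in P' -> p \in P /\ ideal V Z (p - p').
  move=> p'; have [/hP'[p pP hp]|] := boolP (p' \in P'); first by exists p.
  (* A default value: [r] is only evaluated on [P']. *)
  by exists 0.
exists (\sum_(p <- P') c p *: r p).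
  by apply: cone_sum => p /rP[rp _]; apply/coneZ/cone_gen.
rewrite -sumrB; apply: ideal_sum => p /rP[_ hp].
by rewrite -scalerBr; apply: idealZ.
Qed.

End IdealsAndCones.

(** * Existence of normal forms and their relation to the ideal *)

Section NormalForms.
Variables (n : nat) (le : rel 'X_{1..n}).
Hypothesis hle : monomial_order le.
Implicit Types (p q r g : {mpoly rat[n]}) (m l : 'X_{1..n}).
Implicit Types (Z G : {fset {mpoly rat[n]}}).

Definition reducible G m : Prop :=
  exists g l, [/\ g \in G, is_lead le g l & (l <= m)%MM].

(** Phrased monomial by monomial, so that it visibly passes to linear combinations. *)
Definition irreducible G p : Prop := {in msupp p, forall m, ~ reducible G m}.

Lemma irreducibleP G p : (forall q, ~ reduces le G p q) <-> irreducible G p.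
Proof.
split=> [nred m mp [g [l [gG lg lm]]]|irr q [g [l [m [gG lg mp lm _]]]]].
  by apply: nred; exists g, l, m; split.
by case: (irr m mp); exists g, l.
Qed.

Lemma irreducibleB G p q :
  irreducible G p -> irreducible G q -> irreducible G (p - q).
Proof.
by move=> hp hq m /msuppB_le; rewrite mem_cat => /orP[/hp|/hq].
Qed.

Lemma irreducible_sumZ (I : eqType) (s : seq I) (c : I -> rat)
    (F : I -> {mpoly rat[n]}) G :
  (forall i, i \in s -> irreducible G (F i)) ->
  irreducible G (\sum_(i <- s) c i *: F i).
Proof.
move=> hF m /msupp_sum_le /flattenP[t /mapP[i]].
by rewrite filter_predT => si -> /msuppZ_le /(hF i si).
Qed.

Lemma exists_lead p : p != 0 -> exists m, is_lead le p m.
Proof.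
rewrite -msupp_eq0; case def_s: (msupp p) => [//|m s] _.
have [|m0 [m0p _] max0] :=
  exists_max_mnm (s := msupp p) (P := fun=> True) hle.
  by exists m; rewrite // def_s inE eqxx.
by exists m0; split=> // m' /max0; apply.
Qed.

(** The step cancels [m], and every monomial it brings in is [m - l] plus a non-leading monomial of
    [g], hence below [m]. *)
Lemma msupp_reduct p g l m m' : is_lead le g l -> (l <= m)%MM ->
  m' \in msupp (p - (p@_m / g@_l) *: ('X_[m - l] * g)) ->
  strict le m' m \/ m' \in msupp p /\ m' != m.
Proof.
move=> [lg max_l] lem m'q; have [_ _ _ _ [_ leD]] := hle.
have ne_m : m' != m.
  (* The coefficient of [m] in ['X_[m - l] * g] is [g@_l], nonzero because [l] is in the support, so
     the quotient cancels exactly. *)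
  apply: contraTneq m'q => ->; rewrite mcoeff_msupp negbK mcoeffB mcoeffZ.
  rewrite ['X_[_] * g]mulrC -[in X in _ * X](submK lem) addmK mcoeffMX.
  by rewrite divfK ?subrr // -mcoeff_msupp.
move: m'q => /msuppB_le; rewrite mem_cat => /orP[m'p|/msuppZ_le].
  by right.
move=> /msuppM_le /allpairsP[[d k] /= [+ kg def_m']].
rewrite msuppX inE => /eqP def_d; left; rewrite /strict ne_m andbT def_m' def_d.
by rewrite -{2}(submK lem) ![(_ - _ + _)%MM]addmC; apply/leD/max_l.
Qed.

(** Reducing at the greatest reducible monomial [m] leaves only smaller reducible ones: the old ones
    by maximality, the new ones by [msupp_reduct]. *)
Lemma reduct_max p G : ~ irreducible G p ->
  exists q m, [/\ reduces le G p q, m \in msupp p, reducible G m &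
    forall m', m' \in msupp q -> reducible G m' -> strict le m' m].
Proof.
move=> nirr; have [|m [mp redm] max_m] :=
  exists_max_mnm (s := msupp p) (P := reducible G) hle.
  apply: NNPP => nex; apply: nirr => m mp redm.
  by apply: nex; exists m.
have [g [l [gG lg lm]]] := redm.
exists (p - (p@_m / g@_l) *: ('X_[m - l] * g)), m; split=> //.
  by exists g, l, m.
move=> m' /(msupp_reduct lg lm)[//|[m'p ne] /(max_m _ m'p) le_m'].
exact/andP.
Qed.

Lemma normal_form_exists G p : exists r, normal_form le G p r.
Proof.
have step p1 p2 : reduces le G p1 p2 -> (exists r, normal_form le G p2 r) ->
    exists r, normal_form le G p1 r.
  move=> red12 [r [redr irr_r]]; exists r; split=> //.
  by apply: rt_trans redr; apply: rt_step.
(* The well-founded induction runs on a strict upper bound [m] of the reducible monomials; a first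
   reduction of [p] supplies the initial bound. *)
suff bounded m p1 : (forall m', m' \in msupp p1 -> reducible G m' ->
    strict le m' m) -> exists r, normal_form le G p1 r.
  have [irr|/reduct_max[p2 [m [red12 _ _ bnd]]]] := classic (irreducible G p).
    by exists p; split; [exact: rt_refl|exact/irreducibleP].
  exact: step red12 (bounded m p2 bnd).
elim/(well_founded_ind (monomial_order_wf hle)): m p1 => m IHm p1 bnd1.
have [irr|nirr] := classic (irreducible G p1).
  by exists p1; split; [exact: rt_refl|exact/irreducibleP].
have [p2 [m2 [red12 m2p1 redm2 bnd2]]] := reduct_max nirr.
exact: step red12 (IHm m2 (bnd1 m2 m2p1 redm2) p2 bnd2).
Qed.

Lemma red_normal_form G p : normal_form le G p (red le G p).
Proof. exact: epsilon_spec (normal_form_exists G p). Qed.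

Lemma red_irreducible G p : irreducible G (red le G p).
Proof. by apply/irreducibleP; case: (red_normal_form G p). Qed.

(** Each reduction subtracts a multiple of an element of [G], and these differences add up along the
    chain. *)
Lemma ideal_sub_red Z G p : (forall g, g \in G -> ideal [set: 'I_n] Z g) ->
  ideal [set: 'I_n] Z (p - red le G p).
Proof.
move=> hG; case: (red_normal_form G p) => + _.
elim=> {p} [p q|p|p q r _ h1 _ h2].
- move=> [g [l [m [gG _ _ _ ->]]]]; rewrite opprB addrC subrK.
  by apply/idealZ/idealM; [exact: polysT|exact: hG].
- by rewrite subrr; apply: ideal0.
- by rewrite -(subrK q p) -addrA; apply: idealD.
Qed.

(** If [p] were nonzero, its leading monomial would be divisible by that of an element of [G], hence
    reducible. *)
Lemma groebner_irreducible_eq0 Z G p : groebner_basis le Z G ->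
  ideal [set: 'I_n] Z p -> irreducible G p -> p = 0.
Proof.
move=> [_ hG] idp irr; apply/eqP; apply: contraT => /exists_lead[m leadm].
by case: (irr m); [case: leadm|apply: hG leadm].
Qed.

End NormalForms.

(** * Reduction inside the subring over [X] *)

Section Elimination.
Variables (n : nat) (le : rel 'X_{1..n}) (X : {set 'I_n}).
Hypothesis hle : monomial_order le.
Implicit Types (p q r g : {mpoly rat[n]}) (G : {fset {mpoly rat[n]}}).

Lemma lead_monomials_polys g l :
  is_lead (elim_order le X) g l -> monomials X l -> polys X g.
Proof.
move=> [_ max_l] hl; apply/polysP => m /max_l le_ml.
exact: elim_order_monomials hle le_ml hl.
Qed.

(** Both the divisor [l] and the quotient [m - l] of a monomial over [X] are over [X], so the
    multiplier as well as [g] stays in the subring. *)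
Lemma polys_reduces G p q : reduces (elim_order le X) G p q -> polys X p ->
  polys X q /\ ideal X [fset g in G | polys X g] (p - q).
Proof.
move=> [g [l [m [gG lg mp lm ->]]]] hp.
have hm := polysP _ _ hp m mp.
have hg : polys X g := lead_monomials_polys lg (monomials_lepm lm hm).
have hX : polys X 'X_[m - l] by apply/polysX/monomials_lepm/hm/lem_subr.
split; first by rewrite -scaleNr; apply/polysD/polysZ/polysM.
rewrite opprB addrC subrK; apply/idealZ/idealM => //.
by apply: ideal_gen; rewrite !inE gG.
Qed.

Lemma polys_red G p : polys X p ->
  polys X (red (elim_order le X) G p) /\
  ideal X [fset g in G | polys X g] (p - red (elim_order le X) G p).
Proof.
have hleX := elim_order_monomial_order X hle.
case: (red_normal_form hleX G p) => + _.
elim=> {p} [p q|p hp|p q r _ IH1 _ IH2 /IH1[/IH2[hr id2] id1]].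
- exact: polys_reduces.
- by split=> //; rewrite subrr; apply: ideal0.
- by split=> //; rewrite -(subrK q p) -addrA; apply: idealD.
Qed.

End Elimination.

(** * The two inclusions for the projected algebraic cone *)

Theorem theorem3p9 (n : nat) (le : rel 'X_{1..n}) (hle : monomial_order le)
    (X : {set 'I_n}) (Z P : {fset {mpoly rat[n]}})
    (ZP' : {fset {mpoly rat[n]}} * {fset {mpoly rat[n]}})
    (hproj : is_project le X Z P ZP') (q : {mpoly rat[n]}) :
  alg_cone X ZP' q <-> alg_cone [set: 'I_n] (Z, P) q /\ polys X q.
Proof.
have hleX := elim_order_monomial_order X hle.
case: hproj => G [hG def_Z' projP]; set leX := elim_order le X in hleX hG projP.
have idG := hG.1; split.
  case=> z [p [/=]]; rewrite def_Z' => -[a ha ->].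
  case/projP=> hp /mono_span_polys pX ->; split; last first.
    apply: polysD => //; apply: polys_sum => g; rewrite !inE => /andP[_ gX].
    exact: polysM.
  have [|p' hp' idp'] :=
    cone_mod_ideal (V := [set: 'I_n]) (Z := Z) (P := P) _ hp.
    move=> _ /imfsetP[/= p1 p1P ->]; exists p1 => //.
    exact: ideal_sub_red.
  (* Writing [p] as [p' - (p' - p)] moves the discrepancy, which lies in the ideal of [Z], into the
     ideal part. *)
  exists (\sum_(g <- [fset g in G | polys X g]) a g * g - (p' - p)), p'.
  split=> //=; last by rewrite opprB -addrA subrK.
  apply: idealB idp'; apply: ideal_sum => g; rewrite !inE => /andP[gG _].
  by apply: idealM; [exact: polysT|exact: idG].
case=> -[z [p [/= idz [c c0 ->] def_q]]] qX.
pose p' := \sum_(p <- P) c p *: red leX G p.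
have [rX idr] := polys_red hle G qX.
have def_p' : red leX G q = p'.
  apply/eqP; rewrite -subr_eq0; apply/eqP.
  apply: (groebner_irreducible_eq0 hleX hG); last first.
    apply: irreducibleB; first exact: red_irreducible.
    by apply: irreducible_sumZ => p1 _; apply: red_irreducible.
  (* Substituting [q = z + \sum_p c_p p] turns the difference into terms that each lie in the ideal
     of [Z]. *)
  have -> : red leX G q - p' =
      z + \sum_(p <- P) c p *: (p - red leX G p) - (q - red leX G q).
    under eq_bigr do rewrite scalerBr.
    by rewrite sumrB addrA -def_q opprB [RHS]addrC addrA subrK.
  apply: idealB; last exact: ideal_sub_red.
  apply: idealD => //; apply: ideal_sum => p1 _; apply: idealZ.
  exact: ideal_sub_red.
(* By [polys_red] the first summand has multipliers over [X], as the ideal taken in the smaller ring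
   demands. *)
exists (q - red leX G q), (red leX G q); rewrite def_Z' subrK; split=> //.
apply/projP; split; last exact/mono_span_polys.
rewrite def_p'; apply: cone_sum => p1 p1P; apply/coneZ/cone_gen => //.
exact: in_imfset.
Qed.
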